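(* Let $p,q\in(0,1]$. The inequality $$(\cos px)^{1/p}<\frac{\sin x}{x}\quad\text{for all }x\in(0,\pi/2)$$ holds if and only if $p\in[p_0,1]$, and the inequality $$\frac{\sin x}{x}<(\cos qx)^{1/q}\quad\text{for all }x\in(0,\pi/2)$$ holds if and only if $q\in(0,1/3]$, where $p_0=0.347307245464\ldots$. Moreover, for all $x\in(0,\pi/2)$, $$\left(\cos\frac{x}{3}\right)^{\alpha}<\frac{\sin x}{x}<\left(\cos\frac{x}{3}\right)^{3},$$ $$(\cos p_0x)^{1/p_0}<\frac{\sin x}{x}<(\cos p_0x)^{1/(3p_0^2)},$$ where $\alpha=\frac{2(\ln\pi-\ln 2)}{\ln 4-\ln 3}$, and the exponents $\alpha$, $3$, $1/p_0$, $1/(3p_0^2)$ are the best constants (that is, in these inequalities on $(0,\pi/2)$ the exponents $\alpha$ and $1/p_0$ of the lower bounds cannot be replaced by smaller numbers, and the exponents $3$ and $1/(3p_0^2)$ of the upper bounds cannot be replaced by larger numbers).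
   Context: The number $p_0=0.347307245464\ldots$ is the unique root in $(0,1)$ of the equation $$\ln\frac{2}{\pi}-\frac{1}{p}\ln\left(\cos\frac{\pi p}{2}\right)=0$$ in the unknown $p$. *)

(* Defs.v *)
From Stdlib Require Export Reals.
Open Scope R_scope.

(* For 0 < p < 1 the argument of the inner [ln] is positive, so the value of
   [ln] at nonpositive arguments (which is 0) plays no role. *)
Definition is_p0 (p : R) : Prop :=
  0 < p < 1 /\ ln (2 / PI) - 1 / p * ln (cos (PI * p / 2)) = 0.

Definition alpha : R := 2 * (ln PI - ln 2) / (ln 4 - ln 3).

(* The function x |-> (cos (p x))^a.  [Rpower] is the genuine real power only
   for a positive base; here 0 < p <= 1 and 0 < x < PI/2 always hold, hence
   cos (p x) > 0. *)
Definition cospow (p a x : R) : R := Rpower (cos (p * x)) a.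

Definition sinc (x : R) : R := sin x / x.

Definition lt_on (f g : R -> R) : Prop :=
  forall x : R, 0 < x < PI / 2 -> f x < g x.

Definition best_lower_exponent (p a : R) : Prop :=
  lt_on (cospow p a) sinc /\
  forall b : R, b < a -> ~ lt_on (cospow p b) sinc.

Definition best_upper_exponent (p a : R) : Prop :=
  lt_on sinc (cospow p a) /\
  forall b : R, a < b -> ~ lt_on sinc (cospow p b).

(* Main.v *)
(* Put U(x) = - ln (sin x / x) and V(x) = - ln (cos (p x)).  For p <= 7/20 the quotient
   V' / U' = p tan (p x) / (1/x - cot x) is strictly decreasing, hence so is V / U (monotone
   form of l'Hopital's rule); its limit at 0 is 3 p^2.  Therefore (cos px)^a < sin x / x on
   (0, PI/2) iff U(PI/2) <= a V(PI/2), and sin x / x < (cos px)^a iff 3 a p^2 <= 1.  Since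
   V(x) / p increases with p, the cases a = 1/p for other p follow from p = p0 and p = 1/3. *)

Require Import Defs.
From Stdlib Require Import Reals Ranalysis5 Lra Lia Machin.
From Coquelicot Require Import Coquelicot.
Open Scope R_scope.

(** * Numerical bounds *)

(** The restriction to small p is forced by the method: expansion at 0 shows that V' / U' decreases
    near 0 when p^2 < 1/5 and increases there when p^2 > 1/5. After clearing denominators and
    doubling angles, the monotonicity becomes an inequality between a function of 2x and s / sin s
    with s = 2px, coupled only through s <= (7/20) * 2x. Low-degree Taylor polynomials then reduce
    it to one polynomial inequality. The limit 3 p^2 is never formed. Its upper half is the
    pointwise inequality V' < 3 p^2 U'; its sharpness comes from an explicit point x at which a
    larger exponent fails. Locating p0 to twelve decimals is exact rational arithmetic, so PI, ln
    (PI / 2) and the two cosines at the ends of the interval must be enclosed slightly more tightly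
    than that. *)

Lemma PI_bounds : 3.1415926535897932 < PI < 3.1415926535897933.
Proof.
  (* PI / 4 = 2 arctan (1/3) + arctan (1/7); consecutive partial sums of the alternating series
     enclose it. *)
  destruct (PI_2_3_7_ineq 8) as [Hl Hu].
  change (S (2 * 8)) with 17%nat in Hl. change (2 * 8)%nat with 16%nat in Hu.
  unfold tg_alt, PI_2_3_7_tg, Ratan_seq in Hl, Hu.
  cbn [sum_f_R0 Nat.mul Nat.add] in Hl, Hu.
  repeat rewrite INR_IZR_INZ in Hl; repeat rewrite INR_IZR_INZ in Hu.
  cbn [Z.of_nat Pos.of_succ_nat Pos.succ] in Hl, Hu.
  lra.
Qed.

Lemma nonneg_of_derive (f df : R -> R) (b : R) :
  f 0 = 0 -> (forall x, 0 <= x <= b -> is_derive f x (df x)) ->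
  (forall x, 0 <= x <= b -> 0 <= df x) -> 0 <= b -> 0 <= f b.
Proof.
  intros H0 Hd Hp Hb.
  destruct (MVT_gen f 0 b df) as [c [Hc Hf]];
    rewrite ?Rmin_left, ?Rmax_right in * by lra.
  - intros; apply Hd; lra.
  - intros y Hy. apply continuity_pt_filterlim.
    apply (ex_derive_continuous f). exists (df y). now apply Hd.
  - rewrite H0 in Hf. pose proof (Hp c Hc). nra.
Qed.

(** Integrates one bound into the next: the derivative [df] of the gap [f] is the gap of an earlier
    bound, possibly times x, and only its sign is left to prove. *)
Ltac by_derive f df :=
  match goal with |- forall x, 0 <= x -> _ =>
    let b := fresh "b" in let Hb := fresh "Hb" in
    intros b Hb; enough (0 <= f b) by (cbv beta in *; lra);
    apply (nonneg_of_derive f df); [ | | | exact Hb ]; clear Hb;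
    [ cbv beta; rewrite ?sin_0, ?cos_0; lra
    | intros x _; cbv beta; auto_derive; [ easy | try field ]
    | cbv beta; intros x [Hx _]; clear b ] end.

(** * The artanh series, with remainder, as a source of logarithm bounds *)

Definition atanh_sum (n : nat) (z : R) : R :=
  sum_f_R0 (fun k => z ^ (2 * k + 1) / INR (2 * k + 1)) n.

(** The constant [c] is 1 for a term of the series and 1 - z^2 for the remainder in its upper
    bound. *)
Lemma is_derive_pow_div (m : nat) (c z : R) : c <> 0 ->
  is_derive (fun x => x ^ (m + 1) / (INR (m + 1) * c)) z (z ^ m / c).
Proof.
  intros Hc. assert (Hm : INR (m + 1) <> 0) by (apply not_0_INR; lia).
  set (N := INR (m + 1)) in *.
  replace (z ^ m / c) with (scal (/ (N * c)) (INR (m + 1) * 1 * z ^ pred (m + 1))).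
  - apply (is_derive_ext (fun x => scal (/ (N * c)) (x ^ (m + 1)))).
    + intro t. unfold scal; simpl; unfold mult; simpl. apply Rmult_comm.
    + apply @is_derive_scal. apply is_derive_pow. apply @is_derive_id.
  - replace (pred (m + 1)) with m by lia. fold N.
    unfold scal; simpl; unfold mult; simpl. field. auto.
Qed.

Lemma is_derive_atanh_sum (n : nat) (z : R) : z ^ 2 <> 1 ->
  is_derive (atanh_sum n) z ((1 - z ^ (2 * n + 2)) / (1 - z ^ 2)).
Proof.
  intros Hz. induction n as [|n IH]; unfold atanh_sum; cbn [sum_f_R0].
  - simpl. auto_derive; [easy|]. simpl in Hz. field. lra.
  - replace ((1 - z ^ (2 * S n + 2)) / (1 - z ^ 2))
      with (plus ((1 - z ^ (2 * n + 2)) / (1 - z ^ 2)) (z ^ (2 * S n))).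
    + apply (is_derive_plus _ (fun z => z ^ (2 * S n + 1) / INR (2 * S n + 1))); [exact IH|].
      apply (is_derive_ext (fun x => x ^ (2 * S n + 1) / (INR (2 * S n + 1) * 1)));
        [intro; now rewrite Rmult_1_r|].
      replace (z ^ (2 * S n)) with (z ^ (2 * S n) / 1) by apply Rdiv_1_r.
      apply is_derive_pow_div. lra.
    + unfold plus; simpl. replace (n + S (n + 0) + 2)%nat with (2 * n + 3)%nat by lia.
      replace (n + S (n + 0))%nat with (2 * n + 1)%nat by lia.
      rewrite !pow_add. simpl. rewrite Nat.add_0_r, pow_add. simpl in Hz. field. lra.
Qed.

(** The truncation error has derivative 2 x^(2n+2) / (1 - x^2), which is nonnegative. Freezing the
    denominator at its least value 1 - z^2 makes the majorant a power of x that integrates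
    explicitly. *)
Lemma atanh_sum_bounds (n : nat) (z : R) : 0 < z < 1 ->
  2 * atanh_sum n z <= ln ((1 + z) / (1 - z)) <=
  2 * (atanh_sum n z + z ^ (2 * n + 3) / (INR (2 * n + 3) * (1 - z ^ 2))).
Proof.
  intros Hz.
  assert (HN : INR (2 * n + 3) <> 0) by (apply not_0_INR; lia).
  assert (S0 : atanh_sum n 0 = 0).
  { apply sum_eq_R0.
    intros i _. rewrite pow_i by lia. unfold Rdiv. ring. }
  assert (Dln : forall x, 0 <= x <= z ->
    is_derive (fun x => ln ((1 + x) / (1 - x))) x (2 / (1 - x ^ 2))).
  { intros x Hx. auto_derive.
    - repeat split; try lra. apply Rdiv_lt_0_compat; lra.
    - field. repeat split; nra. }
  assert (Dsum : forall x, 0 <= x <= z -> is_derive (atanh_sum n) x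
     ((1 - x ^ (2 * n + 2)) / (1 - x ^ 2))).
  { intros x Hx. apply is_derive_atanh_sum. nra. }
  assert (L0 : ln ((1 + 0) / (1 - 0)) = 0).
  { replace ((1 + 0) / (1 - 0)) with 1 by field. apply ln_1. }
  split; apply Rminus_le_0.
  - apply (nonneg_of_derive (fun x => ln ((1 + x) / (1 - x)) - 2 * atanh_sum n x)
             (fun x => 2 * x ^ (2 * n + 2) / (1 - x ^ 2))); [lra| | |lra].
    + intros x Hx.
      replace (2 * _ / _) with (minus (2 / (1 - x ^ 2))
        (scal 2 ((1 - x ^ (2 * n + 2)) / (1 - x ^ 2)))).
      * apply @is_derive_minus; [now apply Dln|].
        apply @is_derive_scal; now apply Dsum.
      * unfold minus, plus, opp, scal; simpl; unfold mult; simpl. field. nra.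
    + intros x Hx. apply Rdiv_le_0_compat; [|nra].
      pose proof (pow_le x (2 * n + 2) (proj1 Hx)). lra.
  - apply (nonneg_of_derive
      (fun x => 2 * (atanh_sum n x + x ^ (2 * n + 3) / (INR (2 * n + 3) * (1 - z ^ 2)))
                - ln ((1 + x) / (1 - x)))
      (fun x => 2 * x ^ (2 * n + 2) * (/ (1 - z ^ 2) - / (1 - x ^ 2)))); [| | |lra].
    + rewrite S0, L0, pow_i by lia. unfold Rdiv. ring.
    + intros x Hx.
      replace (2 * _ * _) with (minus (scal 2 (plus
         ((1 - x ^ (2 * n + 2)) / (1 - x ^ 2)) (x ^ (2 * n + 2) / (1 - z ^ 2))))
         (2 / (1 - x ^ 2))).
      * apply @is_derive_minus; [|now apply Dln].
        apply @is_derive_scal. apply @is_derive_plus; [now apply Dsum|].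
        replace (2 * n + 3)%nat with ((2 * n + 2) + 1)%nat by lia.
        apply is_derive_pow_div. nra.
      * unfold minus, plus, opp, scal; simpl; unfold mult; simpl. field. nra.
    + intros x Hx. apply Rmult_le_pos.
      * pose proof (pow_le x (2 * n + 2) (proj1 Hx)). lra.
      * apply -> Rminus_le_0. apply Rinv_le_contravar; nra.
Qed.

(** * Low-degree Taylor bounds for the analytic inequalities *)

Lemma sin_ub1 : forall x, 0 <= x -> sin x <= x.
Proof.
  by_derive (fun x => x - sin x) (fun x => 1 - cos x).
  pose proof (COS_bound x). lra.
Qed.

Lemma cos_lb2 : forall x, 0 <= x -> 1 - x ^ 2 / 2 <= cos x.
Proof.
  by_derive (fun x => cos x - (1 - x ^ 2 / 2)) (fun x => x - sin x).
  pose proof (sin_ub1 x Hx). lra.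
Qed.

Lemma sin_lb3 : forall x, 0 <= x -> x - x ^ 3 / 6 <= sin x.
Proof.
  by_derive (fun x => sin x - (x - x ^ 3 / 6)) (fun x => cos x - (1 - x ^ 2 / 2)).
  pose proof (cos_lb2 x Hx). lra.
Qed.

Lemma cos_ub4 : forall x, 0 <= x -> cos x <= 1 - x ^ 2 / 2 + x ^ 4 / 24.
Proof.
  by_derive (fun x => 1 - x ^ 2 / 2 + x ^ 4 / 24 - cos x)
            (fun x => sin x - (x - x ^ 3 / 6)).
  pose proof (sin_lb3 x Hx). lra.
Qed.

Lemma sin_ub5 : forall x, 0 <= x -> sin x <= x - x ^ 3 / 6 + x ^ 5 / 120.
Proof.
  by_derive (fun x => x - x ^ 3 / 6 + x ^ 5 / 120 - sin x)
            (fun x => 1 - x ^ 2 / 2 + x ^ 4 / 24 - cos x).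
  pose proof (cos_ub4 x Hx). lra.
Qed.

Lemma cos_lb6 : forall x, 0 <= x ->
  1 - x ^ 2 / 2 + x ^ 4 / 24 - x ^ 6 / 720 <= cos x.
Proof.
  by_derive (fun x => cos x - (1 - x ^ 2 / 2 + x ^ 4 / 24 - x ^ 6 / 720))
            (fun x => x - x ^ 3 / 6 + x ^ 5 / 120 - sin x).
  pose proof (sin_ub5 x Hx). lra.
Qed.

(** The combination sin x - x cos x is the numerator of U', and its derivative is x sin x. Bounding
    it as a whole avoids the loss from estimating sine and cosine separately. *)
Lemma sin_sub_mul_cos_ub : forall x, 0 <= x ->
  sin x - x * cos x <= x ^ 3 / 3 - x ^ 5 / 30 + x ^ 7 / 840.
Proof.
  by_derive (fun x => x ^ 3 / 3 - x ^ 5 / 30 + x ^ 7 / 840 - (sin x - x * cos x))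
            (fun x => x * (x - x ^ 3 / 6 + x ^ 5 / 120 - sin x)).
  pose proof (sin_ub5 x Hx). nra.
Qed.

Lemma sin_sub_mul_cos_lb : forall x, 0 <= x ->
  x ^ 3 / 3 - x ^ 5 / 30 <= sin x - x * cos x.
Proof.
  by_derive (fun x => sin x - x * cos x - (x ^ 3 / 3 - x ^ 5 / 30))
            (fun x => x * (sin x - (x - x ^ 3 / 6))).
  pose proof (sin_lb3 x Hx). nra.
Qed.

Lemma two_versin_sub_mul_sin_ub : forall x, 0 <= x ->
  2 * (1 - cos x) - x * sin x <= x ^ 4 / 12 - x ^ 6 / 180 + x ^ 8 / 6720.
Proof.
  by_derive (fun x => x ^ 4 / 12 - x ^ 6 / 180 + x ^ 8 / 6720
                      - (2 * (1 - cos x) - x * sin x))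
            (fun x => x ^ 3 / 3 - x ^ 5 / 30 + x ^ 7 / 840 - (sin x - x * cos x)).
  pose proof (sin_sub_mul_cos_ub x Hx). lra.
Qed.

(** * Rational enclosures of logarithms and cosines, and the location of p0 *)

Ltac eval_INR H :=
  repeat rewrite INR_IZR_INZ in H; cbn [Z.of_nat Pos.of_succ_nat Pos.succ] in H.

(* 0.2220... is z = (PI / 2 - 1) / (PI / 2 + 1), so that ln (PI / 2) = 2 artanh z. *)
Lemma ln_half_PI_bounds : 0.45158270528945 < ln (PI / 2) < 0.45158270528946.
Proof.
  pose proof PI_bounds.
  assert (Hz : forall z, z = 0.2220309407033145 \/ z = 0.2220309407033146 ->
    2 * atanh_sum 9 z <= ln ((1 + z) / (1 - z)) <=
    2 * (atanh_sum 9 z + z ^ 21 / (21 * (1 - z ^ 2)))).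
  { intros z Hz. replace 21 with (INR 21) by (simpl; lra).
    apply (atanh_sum_bounds 9). destruct Hz; subst; lra. }
  unfold atanh_sum in Hz. cbn [sum_f_R0 Nat.mul Nat.add] in Hz.
  split.
  - specialize (Hz _ (or_introl eq_refl)). eval_INR Hz.
    apply Rlt_le_trans with (ln ((1 + 0.2220309407033145) / (1 - 0.2220309407033145))).
    + lra.
    + clear Hz. apply ln_le; lra.
  - specialize (Hz _ (or_intror eq_refl)). eval_INR Hz.
    apply Rle_lt_trans with (ln ((1 + 0.2220309407033146) / (1 - 0.2220309407033146))).
    + clear Hz. apply ln_le; lra.
    + lra.
Qed.

Lemma cos_taylor_lb (a : R) : 0 <= a <= PI / 2 ->
  1 - a ^ 2 / 2 + a ^ 4 / 24 - a ^ 6 / 720 + a ^ 8 / 40320 - a ^ 10 / 3628800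
    + a ^ 12 / 479001600 - a ^ 14 / 87178291200 <= cos a.
Proof.
  intros Ha. destruct (cos_bound a 3) as [H _]; [lra|lra|].
  refine (Rle_trans _ _ _ _ H). clear H.
  unfold cos_approx, cos_term. cbn [sum_f_R0 Nat.mul Nat.add].
  assert (F : forall n, INR (Factorial.fact (S n)) = INR (S n) * INR (Factorial.fact n))
    by (intro; rewrite <- mult_INR; reflexivity).
  rewrite !F. rewrite !INR_IZR_INZ. cbn [Z.of_nat Pos.of_succ_nat Pos.succ]. simpl. lra.
Qed.

Lemma cos_taylor_ub (a : R) : 0 <= a <= PI / 2 ->
  cos a <= 1 - a ^ 2 / 2 + a ^ 4 / 24 - a ^ 6 / 720 + a ^ 8 / 40320 - a ^ 10 / 3628800
    + a ^ 12 / 479001600.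
Proof.
  intros Ha. destruct (cos_bound a 2) as [_ H]; [lra|lra|].
  refine (Rle_trans _ _ _ H _). clear H.
  unfold cos_approx, cos_term. cbn [sum_f_R0 Nat.mul Nat.add].
  assert (F : forall n, INR (Factorial.fact (S n)) = INR (S n) * INR (Factorial.fact n))
    by (intro; rewrite <- mult_INR; reflexivity).
  rewrite !F. rewrite !INR_IZR_INZ. cbn [Z.of_nat Pos.of_succ_nat Pos.succ]. simpl. lra.
Qed.

Definition p0_gap (p : R) : R := ln (2 / PI) - 1 / p * ln (cos (PI * p / 2)).

Lemma p0_gap_eq (p : R) : p0_gap p = - ln (PI / 2) + 1 / p * - ln (cos (PI * p / 2)).
Proof.
  unfold p0_gap. replace (2 / PI) with (/ (PI / 2)) by (field; apply PI_neq0).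
  rewrite ln_Rinv by (pose proof PI_RGT_0; lra). ring.
Qed.

Lemma atanh_sum_5_bounds (z : R) : 0 < z < 1 ->
  2 * atanh_sum 5 z <= ln ((1 + z) / (1 - z)) <=
  2 * (atanh_sum 5 z + z ^ 13 / (13 * (1 - z ^ 2))).
Proof.
  intros Hz. replace 13 with (INR 13) by (simpl; lra). now apply (atanh_sum_bounds 5).
Qed.

Lemma neg_ln_le_mobius (c w : R) : 0 < w < 1 -> (1 - w) / (1 + w) <= c ->
  - ln c <= ln ((1 + w) / (1 - w)).
Proof.
  intros Hw Hc.
  assert (0 < (1 - w) / (1 + w)) by (apply Rdiv_lt_0_compat; lra).
  rewrite <- ln_Rinv by lra. apply ln_le; [apply Rinv_0_lt_compat; lra|].
  replace ((1 + w) / (1 - w)) with (/ ((1 - w) / (1 + w))) by (field; lra).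
  now apply Rinv_le_contravar.
Qed.

Lemma neg_ln_ge_mobius (c w : R) : 0 < w < 1 -> 0 < c <= (1 - w) / (1 + w) ->
  ln ((1 + w) / (1 - w)) <= - ln c.
Proof.
  intros Hw Hc. rewrite <- ln_Rinv by lra. apply ln_le.
  - apply Rdiv_lt_0_compat; lra.
  - replace ((1 + w) / (1 - w)) with (/ ((1 - w) / (1 + w))) by (field; lra).
    now apply Rinv_le_contravar.
Qed.

(* With c = cos (PI p / 2), the constant 0.0782... is (1 - c) / (1 + c), rounded so as to
   give a bound on ln c = - 2 artanh ((1 - c) / (1 + c)). *)
Lemma p0_gap_lower : p0_gap 0.347307245464 < 0.
Proof.
  pose proof PI_bounds as HPI. pose proof ln_half_PI_bounds as HL.
  rewrite p0_gap_eq.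
  assert (Hc : (1 - 0.0782586204151442) / (1 + 0.0782586204151442)
               <= cos (PI * 0.347307245464 / 2)).
  (* The constant is PI * 0.347307245464 / 2 rounded up, so its cosine is a lower bound. *)
  { apply Rle_trans with (cos 0.5455489454441048).
    - refine (Rle_trans _ _ _ _ (cos_taylor_lb _ _)); lra.
    - apply Rlt_le, cos_decreasing_1; lra. }
  apply neg_ln_le_mobius in Hc; [|lra].
  destruct (atanh_sum_5_bounds 0.0782586204151442) as [_ Hw]; [lra|].
  unfold atanh_sum in Hw. cbn [sum_f_R0 Nat.mul Nat.add] in Hw. eval_INR Hw.
  assert (- ln (cos (PI * 0.347307245464 / 2)) < 0.347307245464 * 0.45158270528945) by lra.
  lra.
Qed.

Lemma p0_gap_upper : 0 < p0_gap 0.347307245465.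
Proof.
  pose proof PI_bounds as HPI. pose proof ln_half_PI_bounds as HL.
  rewrite p0_gap_eq.
  assert (Hc : 0 < cos (PI * 0.347307245465 / 2)
               <= (1 - 0.078258620415616) / (1 + 0.078258620415616)).
  { split; [apply cos_gt_0; lra|].
    (* Here PI * 0.347307245465 / 2 is rounded down. *)
    apply Rle_trans with (cos 0.5455489454456755).
    - apply Rlt_le, cos_decreasing_1; lra.
    - refine (Rle_trans _ _ _ (cos_taylor_ub _ _) _); lra. }
  apply neg_ln_ge_mobius in Hc; [|lra].
  destruct (atanh_sum_5_bounds 0.078258620415616) as [Hw _]; [lra|].
  unfold atanh_sum in Hw. cbn [sum_f_R0 Nat.mul Nat.add] in Hw. eval_INR Hw.
  assert (0.347307245465 * 0.45158270528946 < - ln (cos (PI * 0.347307245465 / 2))) by lra.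
  lra.
Qed.

(** * Monotonicity of ln cos (p x) / ln (sin x / x) *)

Definition neg_ln_sinc (x : R) : R := - ln (sin x / x).
Definition neg_ln_cos (p x : R) : R := - ln (cos (p * x)).

(* The interval (0, 8/5) contains PI / 2, so the endpoint needs no limit argument;
   7/20 exceeds both 1/3 and p0. *)
Lemma sin_pos_8_5 (x : R) : 0 < x < 8 / 5 -> 0 < sin x.
Proof. intros Hx. pose proof PI_bounds. apply sin_gt_0; lra. Qed.

Lemma cos_pos_7_20 (p x : R) : 0 < p <= 7 / 20 -> 0 < x < 8 / 5 -> 0 < cos (p * x).
Proof. intros Hp Hx. pose proof PI_bounds. apply cos_gt_0; nra. Qed.

Lemma sin_sub_mul_cos_pos (x : R) : 0 < x < 8 / 5 -> 0 < sin x - x * cos x.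
Proof.
  intros Hx. refine (Rlt_le_trans _ _ _ _ (sin_sub_mul_cos_lb x _)); [|lra].
  replace (_ - _) with (x ^ 3 * (1 / 3 - x ^ 2 / 30)) by field.
  apply Rmult_lt_0_compat; [apply pow_lt; lra|nra].
Qed.

(* With y = 2x and s = 2px this says, up to a positive factor, that the derivative of
   [deriv_ratio p] is negative. *)
Lemma wronskian_double_angle (y s : R) : 0 < y < 16 / 5 -> 0 < s <= 7 / 20 * y ->
  s * (2 * (1 - cos y) - y * sin y) < sin s * (y ^ 2 - 2 * (1 - cos y)).
Proof.
  intros Hy Hs.
  pose proof (two_versin_sub_mul_sin_ub y ltac:(lra)) as HN.
  pose proof (cos_lb6 y ltac:(lra)) as HD.
  pose proof (sin_lb3 s ltac:(lra)) as HS.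
  set (u := y ^ 2).
  assert (Hu : 0 < u < 10.24) by (unfold u; nra).
  assert (Hs2 : s ^ 2 <= 49 / 400 * u) by (unfold u; nra).
  assert (Hq : 0 < 1 / 12 - u / 360) by lra.
  (* The three Taylor bounds divided by u^2 or s, with s^2 / 6 <= 49/2400 u. The difference of the
     two sides is u times a decreasing linear factor that vanishes near u = 11.7, beyond the
     required 10.24. *)
  assert (Hp : 1 / 12 - u / 180 + u ^ 2 / 6720 < (1 - 49 / 2400 * u) * (1 / 12 - u / 360)) by nra.
  apply Rle_lt_trans with (s * (u ^ 2 * (1 / 12 - u / 180 + u ^ 2 / 6720))).
  { apply Rmult_le_compat_l; [lra|]. unfold u. lra. }
  apply Rlt_le_trans with (s * (1 - 49 / 2400 * u) * (u ^ 2 * (1 / 12 - u / 360))).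
  { rewrite Rmult_assoc. apply Rmult_lt_compat_l; [lra|].
    rewrite <- Rmult_assoc, (Rmult_comm (1 - _)), Rmult_assoc.
    apply Rmult_lt_compat_l; nra. }
  apply Rmult_le_compat.
  - apply Rmult_le_pos; lra.
  - apply Rmult_le_pos; nra.
  - nra.
  - unfold u. lra.
Qed.

Lemma wronskian_neg (p x : R) : 0 < p <= 7 / 20 -> 0 < x < 8 / 5 ->
  p * x * sin x * (sin x - x * cos x) < sin (p * x) * cos (p * x) * (x ^ 2 - sin x ^ 2).
Proof.
  intros Hp Hx.
  pose proof (wronskian_double_angle (2 * x) (2 * (p * x)) ltac:(lra) ltac:(nra)) as H.
  rewrite !sin_2a, cos_2a_sin in H. nra.
Qed.

(** Multiplied by x cos (px) sin x, this compares sin (px) sin x with cos (px) (sin x - x cos x).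
    Taylor bounds leave a polynomial inequality in u = x^2 and r = (px)^2 <= 49/400 u. *)
Lemma deriv_neg_ln_cos_lt (p x : R) : 0 < p <= 7 / 20 -> 0 < x < 8 / 5 ->
  p * sin (p * x) / cos (p * x) < 3 * p ^ 2 * (1 / x - cos x / sin x).
Proof.
  intros Hp Hx.
  pose proof (sin_pos_8_5 x Hx) as Hsin. pose proof (cos_pos_7_20 p x Hp Hx) as Hcos.
  set (s := p * x) in *.
  assert (Hs : 0 < s) by (unfold s; nra).
  assert (E : s * sin s * sin x < 3 * s ^ 2 / x * cos s * (sin x - x * cos x) / x).
  { pose proof (sin_sub_mul_cos_lb x ltac:(lra)) as H1.
    pose proof (sin_ub5 x ltac:(lra)) as H2.
    pose proof (sin_ub5 s ltac:(lra)) as H3.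
    pose proof (cos_lb2 s ltac:(lra)) as H4.
    set (u := x ^ 2). set (q := p ^ 2).
    assert (Hu : 0 < u < 2.56) by (unfold u; nra).
    assert (Hq : 0 < q <= 49 / 400) by (unfold q; nra).
    assert (Hsu : s ^ 2 = q * u) by (unfold s, q, u; ring).
    apply Rle_lt_trans with (s * (s * (1 - q * u / 6 + (q * u) ^ 2 / 120))
                          * (x * (1 - u / 6 + u ^ 2 / 120))).
    { apply Rmult_le_compat; try lra.
      - apply Rmult_le_pos; [lra|]. apply Rlt_le, sin_gt_0; pose proof PI_bounds; unfold s; nra.
      - apply Rmult_le_compat_l; [lra|]. rewrite <- Hsu. lra.
      - unfold u. lra. }
    apply Rlt_le_trans with (3 * s ^ 2 / x * (1 - q * u / 2) * (x ^ 3 * (1 / 3 - u / 30)) / x).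
    2:{ unfold Rdiv at 1 3. apply Rmult_le_compat_r; [apply Rlt_le, Rinv_0_lt_compat; lra|].
        apply Rmult_le_compat.
        - apply Rmult_le_pos; [|nra]. apply Rlt_le, Rdiv_lt_0_compat; nra.
        - apply Rmult_le_pos; [apply pow_le|]; lra.
        - apply Rmult_le_compat_l; [apply Rlt_le, Rdiv_lt_0_compat; nra|].
          rewrite <- Hsu. lra.
        - unfold u. lra. }
    replace (3 * s ^ 2 / x * (1 - q * u / 2) * (x ^ 3 * (1 / 3 - u / 30)) / x)
      with (s ^ 2 * x * ((1 - q * u / 2) * (1 - u / 10))) by (field; lra).
    replace (s * _ * _)
      with (s ^ 2 * x * ((1 - q * u / 6 + (q * u) ^ 2 / 120) * (1 - u / 6 + u ^ 2 / 120))) by ring.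
    apply Rmult_lt_compat_l; [apply Rmult_lt_0_compat; nra|].
    assert (Hr : 0 < q * u < 0.3136) by nra.
    set (r := q * u) in *.
    assert (Hru : r <= 49 / 400 * u) by (unfold r; nra).
    (* The slope 0.164 < 1/6 absorbs r^2 / 120 for r < 0.3136. Below, 0.336 = 1/2 - 0.164, and the
       products r u and r u^2 enter with favourable signs. *)
    apply Rle_lt_trans with ((1 - 0.164 * r) * (1 - u / 6 + u ^ 2 / 120)).
    { apply Rmult_le_compat_r; nra. }
    assert (0 < u * (1 / 15 - 0.336 * 49 / 400 - u / 120)) by (apply Rmult_lt_0_compat; lra).
    assert (0 <= r * u) by nra. assert (0 <= r * u ^ 2) by nra. nra. }
  apply Rmult_lt_reg_r with (x * cos s * sin x).
  { repeat apply Rmult_lt_0_compat; lra. }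
  replace (p * sin s / cos s * (x * cos s * sin x)) with (s * sin s * sin x)
    by (unfold s at 1; field; lra).
  replace (3 * p ^ 2 * _ * _) with (3 * s ^ 2 / x * cos s * (sin x - x * cos x) / x); [exact E|].
  unfold s at 1. field. lra.
Qed.

Lemma neg_ln_cos_pos (p x : R) : 0 < p * x < PI / 2 -> 0 < neg_ln_cos p x.
Proof.
  intros Hx. unfold neg_ln_cos. enough (ln (cos (p * x)) < ln 1) by (rewrite ln_1 in *; lra).
  apply ln_increasing; [apply cos_gt_0; lra|].
  rewrite <- cos_0. apply cos_decreasing_1; pose proof PI_bounds; lra.
Qed.

Lemma one_sub_inv_le_ln (t : R) : 0 < t -> 1 - 1 / t <= ln t.
Proof.
  intros Ht. pose proof (exp_ineq1_le (- ln t)) as H.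
  rewrite <- ln_Rinv, exp_ln in H by (try apply Rinv_0_lt_compat; lra).
  rewrite ln_Rinv in H by lra. lra.
Qed.

(** From -ln t <= 1 / t - 1 at t = sin x / x >= 1 - x^2 / 6. The leading coefficient 1/6 is exact,
    as the sharpness of the upper exponents requires. *)
Lemma neg_ln_sinc_ub (x : R) : 0 < x < 8 / 5 -> neg_ln_sinc x * (1 - x ^ 2 / 6) <= x ^ 2 / 6.
Proof.
  intros Hx. pose proof (sin_pos_8_5 x Hx).
  pose proof (sin_lb3 x ltac:(lra)).
  assert (Hq : 0 < 1 - x ^ 2 / 6 <= sin x / x).
  { split; [nra|]. apply Rmult_le_reg_r with x; [lra|]. unfold Rdiv at 2.
    rewrite Rmult_assoc, Rinv_l; lra. }
  pose proof (one_sub_inv_le_ln (sin x / x) ltac:(lra)) as HL.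
  assert (1 / (sin x / x) <= 1 / (1 - x ^ 2 / 6))
    by (unfold Rdiv at 1 3; rewrite !Rmult_1_l; apply Rinv_le_contravar; lra).
  assert (E : 1 / (1 - x ^ 2 / 6) * (1 - x ^ 2 / 6) = 1) by (field; nra).
  unfold neg_ln_sinc. nra.
Qed.

(** A crude bound, used as the linear hypothesis of [pos_of_derive_pos]. *)
Lemma neg_ln_sinc_ub_linear (x : R) : 0 < x < 8 / 5 -> neg_ln_sinc x <= x.
Proof.
  intros Hx. pose proof (neg_ln_sinc_ub x Hx).
  apply Rmult_le_reg_r with (1 - x ^ 2 / 6); [nra|].
  refine (Rle_trans _ _ _ H _). nra.
Qed.

Lemma neg_ln_cos_ub_linear (p x : R) : 0 < p <= 7 / 20 -> 0 < x < 8 / 5 -> neg_ln_cos p x <= x.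
Proof.
  intros Hp Hx. pose proof (cos_pos_7_20 p x Hp Hx) as Hc.
  pose proof (one_sub_inv_le_ln _ Hc). pose proof (cos_lb2 (p * x) ltac:(nra)).
  assert (Hs : 0 < p * x < 0.56) by nra.
  assert (p * x <= 0.35 * x) by nra.
  assert (1 / cos (p * x) * cos (p * x) = 1) by (field; lra).
  unfold neg_ln_cos. set (s := p * x) in *. set (c := cos s) in *.
  assert (1 / c <= 1 + s) by (apply Rmult_le_reg_r with c; nra).
  lra.
Qed.

Lemma is_derive_neg_ln_sinc (x : R) : 0 < x < 8 / 5 ->
  is_derive neg_ln_sinc x (1 / x - cos x / sin x).
Proof.
  intros Hx. pose proof (sin_pos_8_5 x Hx). unfold neg_ln_sinc. auto_derive.
  - repeat split; try lra. apply Rdiv_lt_0_compat; lra.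
  - field. lra.
Qed.

Lemma is_derive_neg_ln_cos (p x : R) : 0 < cos (p * x) ->
  is_derive (neg_ln_cos p) x (p * sin (p * x) / cos (p * x)).
Proof. intros Hx. unfold neg_ln_cos. auto_derive; [easy|field; lra]. Qed.

(* The linear lower bound replaces continuity of [f] at 0, where [sin x / x] takes a
   junk value. *)
Lemma pos_of_derive_pos (f df : R -> R) (b K : R) :
  (forall x, 0 < x <= b -> is_derive f x (df x)) ->
  (forall x, 0 < x < b -> 0 < df x) ->
  (forall x, 0 < x <= b -> - K * x <= f x) ->
  0 < b -> 0 < f b.
Proof.
  intros Hd Hp HK Hb.
  assert (Hinc : forall x y, 0 < x -> x < y -> y <= b -> f x < f y).
  { intros x y Hx Hxy Hy.
    destruct (MVT_cor2 f df x y Hxy) as [c [Hf Hc]].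
    - intros c Hc. apply is_derive_Reals, Hd. lra.
    - pose proof (Hp c ltac:(lra)). nra. }
  enough (0 <= f (b / 2)) by (pose proof (Hinc (b / 2) b); lra).
  destruct (Rle_or_lt 0 (f (b / 2))) as [H|H]; [exact H|exfalso].
  set (e := - f (b / 2)).
  (* Since M > |K|, any t <= e / M has f t >= - K t > - e = f (b / 2), while t < b / 2 forces the
     opposite order. *)
  set (M := Rabs K + 1). assert (HM : 0 < M) by (unfold M; pose proof (Rabs_pos K); lra).
  set (t := Rmin (b / 4) (e / M)).
  assert (He : 0 < e / M) by (apply Rdiv_lt_0_compat; unfold e; lra).
  assert (Ht : 0 < t) by (apply Rmin_pos; lra).
  assert (Ht1 : t <= b / 4) by apply Rmin_l.
  assert (Ht2 : t <= e / M) by apply Rmin_r.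
  assert (t * M <= e) by (replace e with (e / M * M) by (field; lra); nra).
  pose proof (Hinc t (b / 2) Ht ltac:(lra) ltac:(lra)).
  pose proof (HK t ltac:(lra)).
  pose proof (Rle_abs K). unfold e, M in *. nra.
Qed.

Lemma deriv_neg_ln_sinc_pos (x : R) : 0 < x < 8 / 5 -> 0 < 1 / x - cos x / sin x.
Proof.
  intros Hx. pose proof (sin_pos_8_5 x Hx). pose proof (sin_sub_mul_cos_pos x Hx).
  replace (1 / x - cos x / sin x) with ((sin x - x * cos x) / (x * sin x)) by (field; lra).
  apply Rdiv_lt_0_compat; nra.
Qed.

Lemma neg_ln_sinc_pos (x : R) : 0 < x < 8 / 5 -> 0 < neg_ln_sinc x.
Proof.
  intros Hx.
  apply (pos_of_derive_pos neg_ln_sinc (fun x => 1 / x - cos x / sin x) x 0); [| | |lra].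
  - intros y Hy. apply is_derive_neg_ln_sinc; lra.
  - intros y Hy. apply deriv_neg_ln_sinc_pos; lra.
  - intros y Hy. unfold neg_ln_sinc. enough (ln (sin y / y) <= ln 1) by (rewrite ln_1 in *; lra).
    pose proof (sin_pos_8_5 y ltac:(lra)). pose proof (sin_ub1 y ltac:(lra)).
    apply ln_le; [apply Rdiv_lt_0_compat; lra|].
    apply Rmult_le_reg_r with y; [lra|]. unfold Rdiv. rewrite Rmult_assoc, Rinv_l; lra.
Qed.

Lemma neg_ln_cos_lt_3p2_neg_ln_sinc (p x : R) : 0 < p <= 7 / 20 -> 0 < x < 8 / 5 ->
  neg_ln_cos p x < 3 * p ^ 2 * neg_ln_sinc x.
Proof.
  intros Hp Hx. apply Rminus_lt_0.
  apply (pos_of_derive_pos (fun x => 3 * p ^ 2 * neg_ln_sinc x - neg_ln_cos p x)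
    (fun x => 3 * p ^ 2 * (1 / x - cos x / sin x) - p * sin (p * x) / cos (p * x)) x 1);
    [| | |lra]; intros y Hy.
  - apply @is_derive_minus; [|apply is_derive_neg_ln_cos, cos_pos_7_20; lra].
    apply @is_derive_scal. apply is_derive_neg_ln_sinc; lra.
  - apply -> Rminus_lt_0. apply deriv_neg_ln_cos_lt; lra.
  - pose proof (neg_ln_cos_ub_linear p y Hp ltac:(lra)). pose proof (neg_ln_sinc_pos y ltac:(lra)).
    assert (0 <= p ^ 2) by nra. nra.
Qed.

(* The quotient of the derivatives of [neg_ln_cos p] and [neg_ln_sinc]. *)
Definition deriv_ratio (p x : R) : R :=
  p * (sin (p * x) / cos (p * x)) * (x * sin x / (sin x - x * cos x)).

(** * Monotone form of l'Hopital's rule for V / U *)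

Lemma is_derive_tan_mul (p x : R) : cos (p * x) <> 0 ->
  is_derive (fun x => p * (sin (p * x) / cos (p * x))) x (p ^ 2 / cos (p * x) ^ 2).
Proof.
  intros Hc. auto_derive; [exact Hc|].
  replace (p ^ 2 / cos (p * x) ^ 2)
    with (p ^ 2 * (sin (p * x) ^ 2 + cos (p * x) ^ 2) / cos (p * x) ^ 2).
  - field. exact Hc.
  - rewrite <- !Rsqr_pow2, sin2_cos2. unfold Rsqr. field. exact Hc.
Qed.

Lemma is_derive_inv_deriv_neg_ln_sinc (x : R) : sin x - x * cos x <> 0 ->
  is_derive (fun x => x * sin x / (sin x - x * cos x)) x
    ((sin x ^ 2 - x ^ 2) / (sin x - x * cos x) ^ 2).
Proof.
  intros Hd. auto_derive; [exact Hd|].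
  replace (sin x ^ 2 - x ^ 2) with (sin x ^ 2 - x ^ 2 * (sin x ^ 2 + cos x ^ 2)).
  - field. exact Hd.
  - rewrite <- !(Rsqr_pow2 (sin x)), <- !(Rsqr_pow2 (cos x)), sin2_cos2. ring.
Qed.

(** The product rule for p tan (px) and 1 / U' gives, over a square, p times the difference that
    [wronskian_neg] makes negative. *)
Lemma deriv_ratio_decreasing (p t x : R) : 0 < p <= 7 / 20 -> 0 < t -> t < x -> x < 8 / 5 ->
  deriv_ratio p x < deriv_ratio p t.
Proof.
  intros Hp Ht Htx Hx.
  destruct (MVT_cor2 (deriv_ratio p) (fun x => p * (p * x * sin x * (sin x - x * cos x)
      - sin (p * x) * cos (p * x) * (x ^ 2 - sin x ^ 2))
      / (cos (p * x) * (sin x - x * cos x)) ^ 2) t x Htx) as [y [Hf Hy]].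
  - intros y Hy. apply is_derive_Reals.
    pose proof (cos_pos_7_20 p y Hp ltac:(lra)). pose proof (sin_sub_mul_cos_pos y ltac:(lra)).
    match goal with |- is_derive _ _ ?e => replace e with
      (plus (mult (p ^ 2 / cos (p * y) ^ 2) (y * sin y / (sin y - y * cos y)))
            (mult (p * (sin (p * y) / cos (p * y)))
                  ((sin y ^ 2 - y ^ 2) / (sin y - y * cos y) ^ 2))) end.
    + apply (is_derive_mult (fun x => p * (sin (p * x) / cos (p * x)))
                            (fun x => x * sin x / (sin x - x * cos x))).
      * apply is_derive_tan_mul. lra.
      * apply is_derive_inv_deriv_neg_ln_sinc. lra.
      * intros; apply Rmult_comm.
    + unfold plus, mult; simpl. field. lra.
  - pose proof (cos_pos_7_20 p y Hp ltac:(lra)).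
    pose proof (sin_sub_mul_cos_pos y ltac:(lra)). pose proof (wronskian_neg p y Hp ltac:(lra)).
    assert (Hd : 0 < (cos (p * y) * (sin y - y * cos y)) ^ 2) by (apply pow_lt; nra).
    apply Rinv_0_lt_compat in Hd.
    assert (Hn : p * (p * y * sin y * (sin y - y * cos y)
      - sin (p * y) * cos (p * y) * (y ^ 2 - sin y ^ 2)) < 0) by nra.
    unfold Rdiv in Hf. set (N := p * (_ - _)) in *. set (D := / _) in *.
    assert (N * D < 0) by nra. nra.
Qed.

(** With r = V'(x) / U'(x), the quotient V' / U' exceeds r to the left of x, so V - r U increases
    from its limit 0 at 0. *)
Lemma deriv_ratio_mul_neg_ln_sinc_lt (p x : R) : 0 < p <= 7 / 20 -> 0 < x < 8 / 5 ->
  deriv_ratio p x * neg_ln_sinc x < neg_ln_cos p x.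
Proof.
  intros Hp Hx. set (r := deriv_ratio p x).
  enough (0 < neg_ln_cos p x - r * neg_ln_sinc x) by lra.
  assert (Hr : 0 < r).
  { unfold r, deriv_ratio. pose proof (cos_pos_7_20 p x Hp Hx). pose proof (sin_pos_8_5 x Hx).
    pose proof (sin_sub_mul_cos_pos x Hx). pose proof PI_bounds.
    assert (0 < sin (p * x)) by (apply sin_gt_0; nra).
    repeat apply Rmult_lt_0_compat; try lra; apply Rinv_0_lt_compat; lra. }
  apply (pos_of_derive_pos (fun x => neg_ln_cos p x - r * neg_ln_sinc x)
    (fun x => p * sin (p * x) / cos (p * x) - r * (1 / x - cos x / sin x)) x r);
    [| | |lra]; intros y Hy.
  - apply @is_derive_minus; [apply is_derive_neg_ln_cos, cos_pos_7_20; lra|].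
    apply @is_derive_scal. apply is_derive_neg_ln_sinc; lra.
  - pose proof (cos_pos_7_20 p y Hp ltac:(lra)). pose proof (sin_pos_8_5 y ltac:(lra)).
    pose proof (sin_sub_mul_cos_pos y ltac:(lra)).
    pose proof (deriv_ratio_decreasing p y x Hp ltac:(lra) ltac:(lra) ltac:(lra)) as Hd.
    replace (p * sin (p * y) / cos (p * y) - r * (1 / y - cos y / sin y))
      with ((deriv_ratio p y - r) * ((sin y - y * cos y) / (y * sin y)))
      by (unfold deriv_ratio; field; lra).
    apply Rmult_lt_0_compat; [unfold r; lra|]. apply Rdiv_lt_0_compat; nra.
  - pose proof (neg_ln_sinc_ub_linear y ltac:(lra)).
    assert (0 < neg_ln_cos p y) by (apply neg_ln_cos_pos; pose proof PI_bounds; nra). nra.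
Qed.

(** With r = V'(t) / U'(t), V' < r U' beyond t gives V(x) - V(t) < r (U(x) - U(t)), and r U(t) <
    V(t) by the preceding lemma. Multiplying by U(t) yields the claim. *)
Lemma neg_ln_ratio_decreasing (p t x : R) : 0 < p <= 7 / 20 -> 0 < t -> t < x -> x < 8 / 5 ->
  neg_ln_cos p x * neg_ln_sinc t < neg_ln_cos p t * neg_ln_sinc x.
Proof.
  intros Hp Ht Htx Hx. set (r := deriv_ratio p t).
  pose proof (deriv_ratio_mul_neg_ln_sinc_lt p t Hp ltac:(lra)) as H1. fold r in H1.
  destruct (MVT_cor2 (fun x => r * neg_ln_sinc x - neg_ln_cos p x)
    (fun x => r * (1 / x - cos x / sin x) - p * sin (p * x) / cos (p * x)) t x Htx)
    as [c [Hf Hc]].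
  { intros c Hc. apply is_derive_Reals.
    apply @is_derive_minus; [|apply is_derive_neg_ln_cos, cos_pos_7_20; lra].
    apply @is_derive_scal. apply is_derive_neg_ln_sinc; lra. }
  assert (Hc1 : 0 < r * (1 / c - cos c / sin c) - p * sin (p * c) / cos (p * c)).
  { pose proof (cos_pos_7_20 p c Hp ltac:(lra)). pose proof (sin_pos_8_5 c ltac:(lra)).
    pose proof (sin_sub_mul_cos_pos c ltac:(lra)).
    pose proof (deriv_ratio_decreasing p t c Hp ltac:(lra) ltac:(lra) ltac:(lra)) as Hd.
    replace (r * (1 / c - cos c / sin c) - p * sin (p * c) / cos (p * c))
      with ((r - deriv_ratio p c) * ((sin c - c * cos c) / (c * sin c)))
      by (unfold deriv_ratio; field; lra).
    apply Rmult_lt_0_compat; [unfold r; lra|]. apply Rdiv_lt_0_compat; nra. }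
  pose proof (neg_ln_sinc_pos t ltac:(lra)). pose proof (neg_ln_sinc_pos x ltac:(lra)).
  assert (HU : neg_ln_sinc t < neg_ln_sinc x).
  { destruct (MVT_cor2 neg_ln_sinc (fun x => 1 / x - cos x / sin x) t x Htx) as [e [He1 He2]].
    - intros e He. apply is_derive_Reals, is_derive_neg_ln_sinc; lra.
    - pose proof (deriv_neg_ln_sinc_pos e ltac:(lra)). nra. }
  assert (HV : neg_ln_cos p x < neg_ln_cos p t + r * (neg_ln_sinc x - neg_ln_sinc t)) by nra.
  nra.
Qed.

(** The function - ln (cos y) / y increases on (0, PI/2): by ln c >= 1 - 1/c, the numerator y tan y
    + ln (cos y) of its derivative is at least (y sin y + cos y - 1) / cos y > 0. No bound 7/20
    enters, so this reaches all exponents up to 1. *)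
Lemma neg_ln_cos_div_p_increasing (p q x : R) : 0 < p < q -> 0 < x -> q * x < PI / 2 ->
  neg_ln_cos p x / p < neg_ln_cos q x / q.
Proof.
  intros Hpq Hx Hqx.
  assert (H : - ln (cos (p * x)) / (p * x) < - ln (cos (q * x)) / (q * x)).
  { apply (incr_function (fun y => - ln (cos y) / y) 0 (PI / 2)
      (fun y => (y * sin y / cos y + ln (cos y)) / y ^ 2)); simpl; try nra.
    - intros y Hy0 Hy1. assert (0 < cos y) by (apply cos_gt_0; lra).
      auto_derive; [lra|]. field. lra.
    - intros y Hy0 Hy1. assert (0 < cos y) by (apply cos_gt_0; lra).
      apply Rdiv_lt_0_compat; [|nra].
      pose proof (one_sub_inv_le_ln (cos y) ltac:(lra)).
      assert (0 < y * sin y + cos y - 1).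
      { apply (pos_of_derive_pos (fun y => y * sin y + cos y - 1) (fun y => y * cos y) y 2);
          [| | |lra]; intros z Hz.
        - auto_derive; [easy|ring].
        - apply Rmult_lt_0_compat; [lra|]. apply cos_gt_0; lra.
        - pose proof (cos_lb2 z ltac:(lra)). pose proof (sin_gt_0 z ltac:(lra) ltac:(lra)).
          pose proof PI_bounds. nra. }
      replace (y * sin y / cos y) with ((y * sin y + cos y - 1) / cos y - 1 + 1 / cos y)
        by (field; lra).
      assert (0 < (y * sin y + cos y - 1) / cos y) by (apply Rdiv_lt_0_compat; lra).
      lra. }
  unfold neg_ln_cos.
  replace (- ln (cos (p * x)) / p) with (- ln (cos (p * x)) / (p * x) * x) by (field; lra).
  replace (- ln (cos (q * x)) / q) with (- ln (cos (q * x)) / (q * x) * x) by (field; lra).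
  nra.
Qed.

(** * Characterisation of the exponents *)

Lemma cospow_lt_sinc_iff (p a x : R) : 0 < p <= 1 -> 0 < x < PI / 2 ->
  cospow p a x < sinc x <-> neg_ln_sinc x < a * neg_ln_cos p x.
Proof.
  intros Hp Hx. unfold cospow, sinc, neg_ln_sinc, neg_ln_cos, Rpower.
  assert (Hs : 0 < sin x / x) by (apply Rdiv_lt_0_compat; [apply sin_gt_0|]; lra).
  rewrite <- (exp_ln (sin x / x)) at 1 by exact Hs.
  split; intros H.
  - apply exp_lt_inv in H. lra.
  - apply exp_increasing. lra.
Qed.

Lemma sinc_lt_cospow_iff (p a x : R) : 0 < p <= 1 -> 0 < x < PI / 2 ->
  sinc x < cospow p a x <-> a * neg_ln_cos p x < neg_ln_sinc x.
Proof.
  intros Hp Hx. unfold cospow, sinc, neg_ln_sinc, neg_ln_cos, Rpower.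
  assert (Hs : 0 < sin x / x) by (apply Rdiv_lt_0_compat; [apply sin_gt_0|]; lra).
  rewrite <- (exp_ln (sin x / x)) at 1 by exact Hs.
  split; intros H.
  - apply exp_lt_inv in H. lra.
  - apply exp_increasing. lra.
Qed.

(** Passage to the limit x -> PI/2, where U and V are still continuous; the strict inequality
    becomes weak. *)
Lemma lower_necessary (p a : R) : 0 < p <= 7 / 20 ->
  lt_on (cospow p a) sinc -> neg_ln_sinc (PI / 2) <= a * neg_ln_cos p (PI / 2).
Proof.
  intros Hp H. pose proof PI_bounds.
  destruct (Rle_or_lt (neg_ln_sinc (PI / 2)) (a * neg_ln_cos p (PI / 2))) as [Hc|Hc];
    [exact Hc|exfalso].
  set (f := fun x => neg_ln_sinc x - a * neg_ln_cos p x).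
  assert (Hf : continuity_pt f (PI / 2)).
  { apply continuity_pt_filterlim, (ex_derive_continuous f).
    eexists. apply @is_derive_minus; [apply is_derive_neg_ln_sinc; lra|].
    apply @is_derive_scal, is_derive_neg_ln_cos, cos_pos_7_20; lra. }
  destruct (Hf (f (PI / 2))) as [d [Hd1 Hd2]]; [unfold f; lra|].
  set (x := PI / 2 - Rmin (d / 2) 1).
  assert (0 < Rmin (d / 2) 1) by (apply Rmin_pos; lra).
  pose proof (Rmin_l (d / 2) 1). pose proof (Rmin_r (d / 2) 1).
  assert (Hx : 0 < x < PI / 2) by (unfold x; lra).
  assert (Hfx : Rabs (f x - f (PI / 2)) < f (PI / 2)).
  { apply Hd2. split.
    - split; [exact I|lra].
    - simpl. unfold Rdist. rewrite Rabs_left; unfold x in *; lra. }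
  apply Rabs_def2 in Hfx.
  specialize (H x Hx). apply cospow_lt_sinc_iff in H; [|lra|exact Hx].
  unfold f in *. lra.
Qed.

(** Equality at PI/2 is allowed because V / U decreases strictly, which restores strictness inside
    the interval. *)
Lemma lower_iff (p a : R) : 0 < p <= 7 / 20 ->
  lt_on (cospow p a) sinc <-> neg_ln_sinc (PI / 2) <= a * neg_ln_cos p (PI / 2).
Proof.
  intros Hp. split; [now apply lower_necessary|].
  intros H x Hx. pose proof PI_bounds. apply cospow_lt_sinc_iff; [lra|exact Hx|].
  pose proof (neg_ln_ratio_decreasing p x (PI / 2) Hp ltac:(lra) ltac:(lra) ltac:(lra)).
  pose proof (neg_ln_sinc_pos x ltac:(lra)). pose proof (neg_ln_sinc_pos (PI / 2) ltac:(lra)).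
  assert (0 < neg_ln_cos p x) by (apply neg_ln_cos_pos; nra).
  assert (0 < neg_ln_cos p (PI / 2)) by (apply neg_ln_cos_pos; nra).
  assert (0 < a) by nra.
  apply Rmult_lt_reg_r with (neg_ln_cos p (PI / 2)); [lra|].
  apply Rlt_le_trans with (neg_ln_cos p x * neg_ln_sinc (PI / 2)); [lra|].
  rewrite (Rmult_comm a), Rmult_assoc. apply Rmult_le_compat_l; lra.
Qed.

(** Only the expansions U ~ x^2 / 6 and V ~ p^2 x^2 / 2 at 0 matter, so p ranges over all of (0,
    1]. *)
Lemma upper_necessary (p a : R) : 0 < p <= 1 ->
  lt_on sinc (cospow p a) -> 3 * a * p ^ 2 <= 1.
Proof.
  intros Hp H. destruct (Rle_or_lt (3 * a * p ^ 2) 1) as [Hk|Hk]; [exact Hk|exfalso].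
  set (k := 3 * a * p ^ 2) in *.
  assert (Hp2 : 0 < p ^ 2 <= 1) by nra.
  assert (Ha : 0 < a) by (unfold k in Hk; nra).
  (* Chosen so that k (1 - x) = 1. The bounds on U and V would give k (1 - x^2 / 12) (1 - x^2 / 6) <
     1, yet that product of brackets exceeds 1 - x on (0, 1). *)
  set (x := 1 - / k).
  assert (Hik : 0 < / k < 1).
  { split; [apply Rinv_0_lt_compat; lra|]. rewrite <- Rinv_1. apply Rinv_lt_contravar; lra. }
  pose proof PI_bounds.
  assert (Hx : 0 < x < 1) by (unfold x; lra).
  specialize (H x ltac:(lra)). apply sinc_lt_cospow_iff in H; [|lra|lra].
  pose proof (neg_ln_sinc_ub x ltac:(lra)) as HU.
  assert (HV : (p * x) ^ 2 / 2 * (1 - x ^ 2 / 12) <= neg_ln_cos p x).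
  { pose proof (cos_ub4 (p * x) ltac:(nra)).
    assert (0 < cos (p * x)) by (apply cos_gt_0; nra).
    pose proof (exp_ineq1_le (ln (cos (p * x)))) as He. rewrite exp_ln in He by lra.
    assert ((p * x) ^ 2 <= x ^ 2) by nra. unfold neg_ln_cos. nra. }
  assert (Hkx : k * (1 - x) = 1) by (unfold x; field; lra).
  assert (E : a * ((p * x) ^ 2 / 2 * (1 - x ^ 2 / 12)) = x ^ 2 / 6 * (k * (1 - x ^ 2 / 12)))
    by (unfold k; field).
  assert (Hlt : x ^ 2 / 6 * (k * (1 - x ^ 2 / 12)) < neg_ln_sinc x).
  { rewrite <- E. refine (Rle_lt_trans _ _ _ _ H). apply Rmult_le_compat_l; lra. }
  assert (H6 : x ^ 2 / 6 * (k * (1 - x ^ 2 / 12) * (1 - x ^ 2 / 6)) < x ^ 2 / 6).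
  { refine (Rlt_le_trans _ _ _ _ HU). rewrite <- Rmult_assoc.
    apply Rmult_lt_compat_r; nra. }
  assert (0 < x ^ 2 / 6) by nra.
  assert (k * (1 - x) < k * (1 - x ^ 2 / 12) * (1 - x ^ 2 / 6)).
  { rewrite Rmult_assoc. apply Rmult_lt_compat_l; nra. }
  nra.
Qed.

Lemma upper_iff (p a : R) : 0 < p <= 7 / 20 ->
  lt_on sinc (cospow p a) <-> 3 * a * p ^ 2 <= 1.
Proof.
  intros Hp. split; [apply upper_necessary; lra|].
  intros H x Hx. pose proof PI_bounds. apply sinc_lt_cospow_iff; [lra|exact Hx|].
  pose proof (neg_ln_cos_lt_3p2_neg_ln_sinc p x Hp ltac:(lra)).
  pose proof (neg_ln_sinc_pos x ltac:(lra)).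
  assert (0 < neg_ln_cos p x) by (apply neg_ln_cos_pos; nra).
  destruct (Rle_or_lt a 0) as [Ha|Ha]; nra.
Qed.

(** * The root p0 and the best exponents *)

(** Identifies p0 as the value for which the exponent 1/p gives equality at PI/2. *)
Lemma p0_gap_neg_ln (p : R) : p0_gap p = neg_ln_cos p (PI / 2) / p - neg_ln_sinc (PI / 2).
Proof.
  rewrite p0_gap_eq. unfold neg_ln_sinc, neg_ln_cos.
  rewrite sin_PI2. replace (1 / (PI / 2)) with (/ (PI / 2)) by (field; apply PI_neq0).
  rewrite ln_Rinv by (pose proof PI_RGT_0; lra).
  replace (p * (PI / 2)) with (PI * p / 2) by field. unfold Rdiv. ring.
Qed.

Lemma p0_gap_increasing (p q : R) : 0 < p < q -> q < 1 -> p0_gap p < p0_gap q.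
Proof.
  intros Hpq Hq. rewrite !p0_gap_neg_ln.
  pose proof (neg_ln_cos_div_p_increasing p q (PI / 2) Hpq). pose proof PI_RGT_0.
  assert (q * (PI / 2) < PI / 2) by nra. lra.
Qed.

Lemma p0_exists : exists p0, 0.347307245464 <= p0 < 0.347307245465 /\ p0_gap p0 = 0.
Proof.
  pose proof p0_gap_lower as Hl. pose proof p0_gap_upper as Hu.
  destruct (IVT_interv p0_gap 0.347307245464 0.347307245465) as [p [Hp H0]].
  - intros p Hp. pose proof PI_bounds.
    assert (0 < cos (PI * p / 2)) by (apply cos_gt_0; nra).
    apply continuity_pt_filterlim, (ex_derive_continuous p0_gap).
    unfold p0_gap. auto_derive. lra.
  - lra.
  - exact Hl.
  - exact Hu.
  - exists p. split; [|exact H0]. split; [lra|].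
    destruct (Rle_lt_or_eq_dec _ _ (proj2 Hp)) as [H|H]; [exact H|].
    exfalso. rewrite H in H0. lra.
Qed.

Lemma lower_best (p a : R) : 0 < p <= 7 / 20 -> a * neg_ln_cos p (PI / 2) = neg_ln_sinc (PI / 2) ->
  best_lower_exponent p a.
Proof.
  intros Hp Ha. pose proof PI_bounds.
  assert (0 < neg_ln_cos p (PI / 2)) by (apply neg_ln_cos_pos; nra).
  split.
  - apply lower_iff; lra.
  - intros b Hb Hlt. apply lower_iff in Hlt; nra.
Qed.

Lemma upper_best (p : R) : 0 < p <= 7 / 20 -> best_upper_exponent p (1 / (3 * p ^ 2)).
Proof.
  intros Hp.
  assert (E : 3 * (1 / (3 * p ^ 2)) * p ^ 2 = 1) by (field; lra).
  split.
  - apply upper_iff; lra.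
  - intros b Hb H. apply upper_iff in H; [|lra].
    assert (0 < p ^ 2) by nra. nra.
Qed.

(** Since cos (PI/6) = sqrt 3 / 2, V(PI/2) = (ln 4 - ln 3) / 2, while U(PI/2) = ln (PI/2). *)
Lemma alpha_eq : alpha * neg_ln_cos (1 / 3) (PI / 2) = neg_ln_sinc (PI / 2).
Proof.
  pose proof PI_RGT_0. unfold alpha, neg_ln_sinc, neg_ln_cos.
  replace (1 / 3 * (PI / 2)) with (PI / 6) by field.
  rewrite cos_PI6, sin_PI2.
  replace (1 / (PI / 2)) with (2 / PI) by (field; lra).
  assert (0 < sqrt 3) by (apply sqrt_lt_R0; lra).
  assert (H3 : ln 3 = 2 * ln (sqrt 3)).
  { rewrite <- (sqrt_sqrt 3) at 1 by lra. rewrite ln_mult by lra. ring. }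
  assert (H4 : ln 4 = 2 * ln 2).
  { replace 4 with (2 * 2) by ring. rewrite ln_mult by lra. ring. }
  assert (ln 3 < ln 4) by (apply ln_increasing; lra).
  rewrite !ln_div by lra. rewrite H3, H4 in *. field. lra.
Qed.

Theorem theorem1 :
  exists p0 : R,
    unique is_p0 p0 /\
    0.347307245464 <= p0 < 0.347307245465 /\
    (forall p : R, 0 < p <= 1 ->
       (lt_on (cospow p (1 / p)) sinc <-> p0 <= p <= 1)) /\
    (forall q : R, 0 < q <= 1 ->
       (lt_on sinc (cospow q (1 / q)) <-> 0 < q <= 1 / 3)) /\
    best_lower_exponent (1 / 3) alpha /\
    best_upper_exponent (1 / 3) 3 /\
    best_lower_exponent p0 (1 / p0) /\
    best_upper_exponent p0 (1 / (3 * p0 ^ 2)).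
Proof.
  destruct p0_exists as [p0 [Hp0 H0]]. exists p0.
  pose proof PI_bounds as HPI.
  assert (Hend : 1 / p0 * neg_ln_cos p0 (PI / 2) = neg_ln_sinc (PI / 2)).
  { rewrite p0_gap_neg_ln in H0. lra. }
  assert (Hlow : best_lower_exponent p0 (1 / p0)) by (apply lower_best; lra).
  assert (Hup : best_upper_exponent (1 / 3) 3).
  { replace 3 with (1 / (3 * (1 / 3) ^ 2)) at 2 by field. apply upper_best; lra. }
  split; [|split; [exact Hp0|split; [|split; [|split; [|split; [exact Hup|split]]]]]].
  - split; [split; [lra|exact H0]|].
    intros p [Hp H]. fold (p0_gap p) in H.
    destruct (Rtotal_order p0 p) as [Hlt|[Heq|Hgt]]; [|exact Heq|].
    + pose proof (p0_gap_increasing p0 p). lra.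
    + pose proof (p0_gap_increasing p p0). lra.
  - intros p Hp. split.
    + intros H. split; [|lra]. destruct (Rle_or_lt p0 p) as [Hle|Hlt]; [exact Hle|exfalso].
      (* Applicable because p < p0 < 7/20; it yields [p0_gap p] >= 0, against monotonicity. *)
      apply lower_necessary in H; [|lra].
      pose proof (p0_gap_increasing p p0 ltac:(lra) ltac:(lra)) as Hg.
      rewrite H0, p0_gap_neg_ln in Hg. lra.
    + intros [[Hlt|Heq] _] x Hx; [|subst p; now apply Hlow].
      apply cospow_lt_sinc_iff; [lra|exact Hx|].
      pose proof (proj1 Hlow x Hx) as H. apply cospow_lt_sinc_iff in H; [|lra|exact Hx].
      pose proof (neg_ln_cos_div_p_increasing p0 p x ltac:(lra) ltac:(lra) ltac:(nra)). lra.
  - intros q Hq. split.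
    + intros H. apply upper_necessary in H; [|lra].
      replace (3 * (1 / q) * q ^ 2) with (3 * q) in H by (field; lra). lra.
    + intros [_ [Hlt|Heq]] x Hx.
      * apply sinc_lt_cospow_iff; [lra|exact Hx|].
        pose proof (proj1 Hup x Hx) as H. apply sinc_lt_cospow_iff in H; [|lra|exact Hx].
        pose proof (neg_ln_cos_div_p_increasing q (1 / 3) x ltac:(lra) ltac:(lra) ltac:(nra)). lra.
      * subst q. replace (1 / (1 / 3)) with 3 by field. now apply Hup.
  - apply lower_best; [lra|apply alpha_eq].
  - exact Hlow.
  - apply upper_best; lra.
Qed.
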